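(* Let $\mathcal L$ be a language containing a binary predicate $<$, and let $\mathcal M=(M,<,\ldots)$ be a $*$-locally weakly o-minimal $\mathcal L$-structure with the univariate $*$-continuity property. Then $(M,\operatorname{discl})$ is a pregeometry.
   Context: $\mathcal M$ is an expansion of a dense linear order without endpoints; ''definable'' means with parameters; order topology. $\overline M=M\cup\{\text{definable gaps}\}$, where a definable gap is a pair $(A,B)$ of nonempty definable subsets of $M$ with $M=A\cup B$, $A<B$, $A$ without maximum, $B$ without minimum, naturally ordered; for an open interval $I=(b_1,b_2)$, $\overline I=\{x\in\overline M:b_1<x<b_2\}$. $*$-locally weakly o-minimal: for every definable $X\subseteq M$ and every $\bar a\in\overline M$ there is an open interval $I$ with $\bar a\in\overline I$ such that $X\cap I$ is a union of a finite set and finitely many open convex sets. A definable function $F:X\to\overline M$ is one given by $F(x)=\sup Y_x$ for a definable $Y$ projecting onto $X$. Univariate $*$-continuity property: for every definable $f:I\to\overline M$ on a nonempty open interval $I$ there is a nonempty open subinterval on which $f$ is continuous. For $A\subseteq M$, $\operatorname{discl}(A)$ is the set of $x\in M$ for which there is an $\mathcal L(A)$-formula $\phi(t)$ such that $\phi(\mathcal M)$ contains $x$ and is discrete and closed. A pair $(S,\operatorname{cl})$ with $\operatorname{cl}:\mathcal P(S)\to\mathcal P(S)$ is a pregeometry if for all $A\subseteq S$: $A\subseteq\operatorname{cl}(A)$; $\operatorname{cl}(\operatorname{cl}(A))=\operatorname{cl}(A)$; for $a,b\in S$, if $a\in\operatorname{cl}(A\cup\{b\})\setminus\operatorname{cl}(A)$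 then $b\in\operatorname{cl}(A\cup\{a\})$; and every $a\in\operatorname{cl}(A)$ lies in $\operatorname{cl}(Y)$ for some finite $Y\subseteq A$. *)

(* Defs.v *)
From HB Require Import structures.
From mathcomp Require Import all_boot all_order all_classical.
From mathcomp Require Import interval interval_inference topology.

Set Implicit Arguments.
Unset Strict Implicit.
Unset Printing Implicit Defensive.
Import Order.TTheory.
Local Open Scope classical_set_scope.
Local Open Scope order_scope.

(* Constant symbols are function symbols of arity 0. *)
Record language := Language {
  fun_sym : nat -> Type;
  rel_sym : nat -> Type }.

Record structure (L : language) (M : Type) := Structure {
  fun_interp : forall n, fun_sym L n -> ('I_n -> M) -> M;
  rel_interp : forall n, rel_sym L n -> ('I_n -> M) -> Prop }.

(* [term L C n] and [formula L C n] are the terms and formulas, with free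
   variables among n variables, of L expanded by a new constant symbol for
   each element of C.  The quantified variable of [All] is the last of n.+1. *)
Inductive term (L : language) (C : Type) (n : nat) : Type :=
  | Var of 'I_n
  | Cst of C
  | App k of fun_sym L k & ('I_k -> term L C n).

Inductive formula (L : language) (C : Type) : nat -> Type :=
  | Bot n : formula L C n
  | Eq n : term L C n -> term L C n -> formula L C n
  | Rel n k : rel_sym L k -> ('I_k -> term L C n) -> formula L C n
  | Imp n : formula L C n -> formula L C n -> formula L C n
  | All n : formula L C n.+1 -> formula L C n.

(* (v_0, ..., v_(n-1), y) *)
Definition extend (M : Type) (n : nat) (v : 'I_n -> M) (y : M) : 'I_n.+1 -> M :=
  fun i => oapp v y (unlift ord_max i).

Section Semantics.
Context (L : language) (M : Type) (S : structure L M).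

Fixpoint eval (C : Type) (c : C -> M) n (v : 'I_n -> M) (t : term L C n) : M :=
  match t with
  | Var i => v i
  | Cst a => c a
  | App k f ts => fun_interp S f (fun i => eval c v (ts i))
  end.

Fixpoint sat (C : Type) (c : C -> M) n (phi : formula L C n) :
    ('I_n -> M) -> Prop :=
  match phi in formula _ _ m return ('I_m -> M) -> Prop with
  | Bot _ => fun=> False
  | Eq _ t u => fun v => eval c v t = eval c v u
  | Rel _ _ r ts => fun v => rel_interp S r (fun i => eval c v (ts i))
  | Imp _ p q => fun v => sat c p v -> sat c q v
  | All _ p => fun v => forall y, sat c p (extend v y)
  end.

(* The subset of M^n defined by an L(A)-formula; [formula L A n] goes through
   the coercion of the set A to the type of its elements. *)
Definition solutions (A : set M) n (phi : formula L A n) : set ('I_n -> M) :=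
  [set v | sat (fun a : A => set_val a) phi v].

Definition definable n (X : set ('I_n -> M)) : Prop :=
  exists phi : formula L [set: M] n, X = solutions phi.

(* X as a subset of M^1 *)
Definition unary (X : set M) : set ('I_1 -> M) := [set v | X (v ord0)].

End Semantics.

Section Completion.
Context (L : language) (d : Order.disp_t) (M : orderType d).
Context (S : structure L M).

Definition is_definable_gap (A B : set M) : Prop :=
  [/\ [/\ definable S (unary A), definable S (unary B), A !=set0 & B !=set0],
      A `|` B = [set: M],
      (forall a b, A a -> B b -> a < b),
      (forall a, A a -> exists2 a', A a' & a < a') &
      (forall b, B b -> exists2 b', B b' & b' < b)].

Record definable_gap := DefinableGap {
  gap_lower : set M;
  gap_upper : set M;
  gapP : is_definable_gap gap_lower gap_upper }.

Inductive completion : Type := Pt of M | Gap of definable_gap.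

Definition completion_le (x y : completion) : bool :=
  match x, y with
  | Pt a, Pt b => a <= b
  | Pt a, Gap g => `[< gap_lower g a >]
  | Gap g, Pt b => `[< gap_upper g b >]
  | Gap g, Gap h => `[< gap_lower g `<=` gap_lower h >]
  end.

Lemma gap_lowerNupper (g : definable_gap) x : ~ gap_lower g x <-> gap_upper g x.
Proof.
case: g => A B /= [_ AB ltAB _ _]; split=> [nA|Bx Ax].
  by have [|] : (A `|` B) x by rewrite AB.
by have := ltAB _ _ Ax Bx; rewrite ltxx.
Qed.

Lemma gap_lower_le (g : definable_gap) x y :
  x <= y -> gap_lower g y -> gap_lower g x.
Proof.
move=> xy gy; apply: contrapT => /gap_lowerNupper gx.
case: g gy gx => A B /= [_ _ ltAB _ _] Ay Bx.
by have := lt_le_trans (ltAB _ _ Ay Bx) xy; rewrite ltxx.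
Qed.

Lemma gap_eq (g h : definable_gap) : gap_lower g = gap_lower h -> g = h.
Proof.
move=> gh; have gh' : gap_upper g = gap_upper h.
  apply/funext => x; apply/propext.
  by rewrite -(gap_lowerNupper g x) -(gap_lowerNupper h x) gh.
case: g h gh gh' => A B gAB [A' B' hAB] /= AA BB.
move: gAB hAB; rewrite AA BB => gAB hAB; congr DefinableGap; exact: Prop_irrelevance.
Qed.

Lemma completion_le_refl : reflexive completion_le.
Proof. by case=> [a|g] /=; [exact: lexx|exact/asboolP]. Qed.

Lemma completion_le_anti : antisymmetric completion_le.
Proof.
case=> [a|g] [b|h] /= /andP[].
- by move=> ab ba; congr Pt; apply: le_anti; rewrite ab.
- by move=> /asboolP ha /asboolP /gap_lowerNupper.
- by move=> /asboolP /gap_lowerNupper ga /asboolP.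
- move=> /asboolP gh /asboolP hg; congr Gap; apply: gap_eq.
  by apply/seteqP.
Qed.

Lemma completion_le_trans : transitive completion_le.
Proof.
case=> [b|h] [a|g] [c|k] //=.
- exact: le_trans.
- by move=> ab /asboolP kb; apply/asboolP; exact: gap_lower_le ab kb.
- move=> /asboolP /gap_lowerNupper gb bc; apply/asboolP/gap_lowerNupper.
  by move=> gc; apply: gb; exact: gap_lower_le bc gc.
- move=> /asboolP /gap_lowerNupper gb /asboolP kb; apply/asboolP => x gx.
  apply: (gap_lower_le _ kb); rewrite leNgt; apply/negP => /ltW bx.
  exact/gb/(gap_lower_le bx).
- move=> /asboolP ha /asboolP /gap_lowerNupper hc.
  rewrite leNgt; apply/negP => /ltW ca; exact/hc/(gap_lower_le ca).
- by move=> /asboolP ha /asboolP hk; apply/asboolP; exact: hk.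
- move=> /asboolP gh /asboolP /gap_lowerNupper hc; apply/asboolP/gap_lowerNupper.
  by move=> /gh.
- by move=> /asboolP gh /asboolP hk; apply/asboolP => x /gh /hk.
Qed.

Lemma completion_le_total : total completion_le.
Proof.
case=> [a|g] [b|h] /=.
- exact: le_total.
- have [ha|ha] := pselect (gap_lower h a); apply/orP; [left|right]; apply/asboolP => //.
  exact/gap_lowerNupper.
- have [ha|ha] := pselect (gap_lower g b); apply/orP; [right|left]; apply/asboolP => //.
  exact/gap_lowerNupper.
- have [gh|/existsNP[x /not_implyP[gx hx]]] :=
    pselect (gap_lower g `<=` gap_lower h); apply/orP; [left|right]; apply/asboolP => //.
  move=> y hy; apply: (gap_lower_le _ gx); rewrite leNgt; apply/negP => /ltW xy.
  exact/hx/(gap_lower_le xy).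
Qed.

HB.instance Definition _ := gen_eqMixin completion.
HB.instance Definition _ := gen_choiceMixin completion.
HB.instance Definition _ := Order.Le_isPOrder.Build d completion
  completion_le_refl completion_le_anti completion_le_trans.
HB.instance Definition _ :=
  Order.POrder_isTotal.Build d completion completion_le_total.
HB.instance Definition _ := OrderTopological.copy completion (order_topology completion).

(* F : X -> completion is represented by a total function of which only the
   restriction to X matters. *)
Definition definable_fun n (X : set ('I_n -> M)) (F : ('I_n -> M) -> completion) :
    Prop :=
  exists Y : set ('I_n.+1 -> M),
    [/\ definable S Y,
        [set v | exists y, Y (extend v y)] = X &
        forall v, X v -> supremums (Pt @` [set y | Y (extend v y)]) (F v)].

End Completion.

Section OMinimality.
Context (L : language) (d : Order.disp_t) (M : orderTopologicalType d).
Context (S : structure L M).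

Definition dense_without_endpoints : Prop :=
  [/\ [set: M] !=set0,
      (forall x y : M, x < y -> exists z, x < z < y),
      (forall x : M, exists y, y < x) &
      (forall x : M, exists y, x < y)].

Definition order_convex (C : set M) : Prop :=
  forall x y z, C x -> C y -> x < z < y -> C z.

Definition star_locally_weakly_o_minimal : Prop :=
  forall X : set M, definable S (unary X) -> forall a : completion S,
  exists I : interval M,
    [/\ itv_open_ends I, a \in map_itv (Pt S) I &
        exists (F : set M) (n : nat) (U : 'I_n -> set M),
          [/\ finite_set F,
              (forall i, open (U i) /\ order_convex (U i)) &
              X `&` [set` I] = F `|` \bigcup_i U i]].

Definition univariate_star_continuity : Prop :=
  forall I : interval M, itv_open_ends I -> [set` I] !=set0 ->
  forall f : M -> completion S,
    definable_fun (unary [set` I]) (fun v => f (v ord0)) ->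
  exists J : interval M,
    [/\ itv_open_ends J, [set` J] !=set0, [set` J] `<=` [set` I] &
        {within [set` J], continuous f}].

Definition discrete_subset (X : set M) : Prop := X `<=` isolated X.

Definition discl (A : set M) : set M :=
  [set x | exists phi : formula L A 1,
     let X := [set t : M | solutions S phi (fun=> t)] in
     [/\ X x, discrete_subset X & closed X]].

End OMinimality.

Definition pregeometry (T : Type) (cl : set T -> set T) : Prop :=
  forall A : set T,
    [/\ A `<=` cl A,
        cl (cl A) = cl A,
        (forall a b, (cl (A `|` [set b]) `\` cl A) a -> cl (A `|` [set a]) b) &
        (forall a, cl A a -> exists Y, [/\ finite_set Y, Y `<=` A & cl Y a])].

(* Main.v *)
(* Call a definable subset of M large if it contains an interval, and small
   otherwise.  By weak o-minimality a definable set is discrete and closed exactly when it is not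
   large, so discl A is the union of the A-definable sets that are not large.

   Both idempotence and exchange follow from one fact about a definable relation
   R: if no fiber {x | R x y} is large, then the set of the x for which the fiber
   {y | R x y} is large is not large either.  Otherwise the interior of {y | R x y} is
   nonempty for all x in some interval; its first convex component above a fixed
   point (or its last one below) is bounded by two definable functions into the
   completion.  These are continuous on a subinterval, so some y lies between
   them for all x near some x0, and {x | R x y} is large.

   Exchange: if R a b with R over A and all {x | R x y} small, then a is not in
   the A-definable small set of the x with {y | R x y} large, so {y | R a y} is
   small, and it contains b.
   Idempotence: the fibers of R over a discrete set D are spread over intervals by
   attaching to y the fiber at the successor of y in D. *)

From mathcomp Require Import all_boot all_order all_classical.
From mathcomp Require Import interval interval_inference topology.
Require Import Defs.

Set Implicit Arguments.
Unset Strict Implicit.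
Unset Printing Implicit Defensive.
Import Order.TTheory.
Local Open Scope order_scope.
Local Open Scope classical_set_scope.

(** * Definability as a closure property *)

Section Definability.
Context (L : language) (M : Type) (S : structure L M).
Implicit Types (A B : set M) (n k : nat).

(** Stated semantically, for maps and predicates on valuations, so that definability follows from
    closure lemmas rather than from explicit formulas. *)
Definition term_definable A n (f : ('I_n -> M) -> M) : Prop :=
  exists t : term L A n, forall v, eval S (fun a : A => set_val a) v t = f v.

Definition formula_definable A n (P : ('I_n -> M) -> Prop) : Prop :=
  exists phi : formula L A n,
    forall v, sat S (fun a : A => set_val a) phi v <-> P v.

Lemma term_definable_var A n (i : 'I_n) :
  term_definable A (fun v : 'I_n -> M => v i).
Proof. by exists (Var L A i). Qed.

Lemma term_definable_cst A n a : A a ->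
  term_definable A (fun _ : 'I_n -> M => a).
Proof.
move=> Aa; exists (Cst L n (SigSub (mem_set Aa))) => v /=.
by rewrite set_valE.
Qed.

Lemma term_definable_app A n k (F : fun_sym L k) (f : 'I_k -> ('I_n -> M) -> M) :
  (forall i, term_definable A (f i)) ->
  term_definable A (fun v => fun_interp S F (fun i => f i v)).
Proof.
move=> /choice[t tE]; exists (App F t) => v /=.
by congr fun_interp; apply/funext => i; rewrite tE.
Qed.

Lemma term_definable_reindex A n m (sigma : 'I_n -> 'I_m)
    (f : ('I_n -> M) -> M) :
  term_definable A f ->
  term_definable A (fun w : 'I_m -> M => f (fun i => w (sigma i))).
Proof.
move=> [t tE]; suff : term_definable A (fun w : 'I_m -> M =>
    eval S (fun a : A => set_val a) (fun i => w (sigma i)) t).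
  by move=> [u uE]; exists u => w; rewrite uE tE.
elim: t {f tE} => [i|a|k F ts IH] /=; last exact: term_definable_app.
- exact: term_definable_var.
- by exists (Cst L m a).
Qed.

Lemma formula_definable_ext A n (P Q : ('I_n -> M) -> Prop) :
  (forall v, P v <-> Q v) -> formula_definable A P -> formula_definable A Q.
Proof. by move=> PQ [phi phiE]; exists phi => v; rewrite phiE. Qed.

Lemma formula_definable_rel A n k (r : rel_sym L k) (f : 'I_k -> ('I_n -> M) -> M) :
  (forall i, term_definable A (f i)) ->
  formula_definable A (fun v => rel_interp S r (fun i => f i v)).
Proof.
move=> /choice[t tE]; exists (Rel r t) => v /=.
by under eq_fun do rewrite tE.
Qed.

Lemma formula_definable_eq A n (f g : ('I_n -> M) -> M) :
  term_definable A f -> term_definable A g ->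
  formula_definable A (fun v => f v = g v).
Proof. by move=> [t tE] [u uE]; exists (Eq t u) => v /=; rewrite tE uE. Qed.

Lemma formula_definable_False A n :
  formula_definable A (fun _ : 'I_n -> M => False).
Proof. by exists (Bot L A n). Qed.

Lemma formula_definable_imp A n (P Q : ('I_n -> M) -> Prop) :
  formula_definable A P -> formula_definable A Q ->
  formula_definable A (fun v => P v -> Q v).
Proof.
move=> [phi phiE] [psi psiE]; exists (Imp phi psi) => v /=.
by rewrite phiE psiE.
Qed.

Lemma formula_definable_all A n (P : ('I_n -> M) -> M -> Prop) :
  formula_definable A
    (fun w : 'I_n.+1 -> M => P (fun i => w (lift ord_max i)) (w ord_max)) ->
  formula_definable A (fun v => forall y, P v y).
Proof.
move=> [phi phiE]; exists (All phi) => v /=.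
have ext y : P (fun i => extend v y (lift ord_max i)) (extend v y ord_max) = P v y.
  congr P; first by apply/funext => i; rewrite /extend liftK.
  by rewrite /extend unlift_none.
by split=> H y; have := H y; rewrite phiE ext.
Qed.

Lemma formula_definable_not A n (P : ('I_n -> M) -> Prop) :
  formula_definable A P -> formula_definable A (fun v => ~ P v).
Proof. by move=> dP; apply: formula_definable_imp => //; exact: formula_definable_False. Qed.

Lemma formula_definable_or A n (P Q : ('I_n -> M) -> Prop) :
  formula_definable A P -> formula_definable A Q ->
  formula_definable A (fun v => P v \/ Q v).
Proof.
move=> dP dQ; apply: formula_definable_ext
  (formula_definable_imp (formula_definable_not dP) dQ) => v; split.
  by move=> PQ; have [?|/PQ] := pselect (P v); [left|right].
by case.
Qed.

Lemma formula_definable_and A n (P Q : ('I_n -> M) -> Prop) :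
  formula_definable A P -> formula_definable A Q ->
  formula_definable A (fun v => P v /\ Q v).
Proof.
move=> dP dQ; apply: formula_definable_ext (formula_definable_not
  (formula_definable_imp dP (formula_definable_not dQ))) => v; split.
  by move=> /not_implyP[? /contrapT].
by case=> Pv Qv; apply.
Qed.

Lemma formula_definable_ex A n (P : ('I_n -> M) -> M -> Prop) :
  formula_definable A
    (fun w : 'I_n.+1 -> M => P (fun i => w (lift ord_max i)) (w ord_max)) ->
  formula_definable A (fun v => exists y, P v y).
Proof.
move=> dP; have /formula_definable_not := formula_definable_all
  (P := fun v y => ~ P v y) (formula_definable_not dP).
apply: formula_definable_ext => v; split; first exact: contra_notP (@forallNP _ _).2.
by move=> [y Py] /(_ y).
Qed.

(* The parameters of [phi] may be replaced by definable terms; with [kappa c]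
   a variable, this turns a parameter into a variable. *)
Lemma formula_definable_subst A C n m (phi : formula L C n)
    (kappa : C -> ('I_m -> M) -> M) (tau : 'I_n -> ('I_m -> M) -> M) :
  (forall c, term_definable A (kappa c)) ->
  (forall i, term_definable A (tau i)) ->
  formula_definable A
    (fun v => sat S (fun c => kappa c v) phi (fun i => tau i v)).
Proof.
have evalP p q (t : term L C p) (kap : C -> ('I_q -> M) -> M)
    (ta : 'I_p -> ('I_q -> M) -> M) :
    (forall c, term_definable A (kap c)) ->
    (forall i, term_definable A (ta i)) ->
    term_definable A (fun v => eval S (fun c => kap c v) (fun i => ta i v) t).
  by move=> dk dt; elim: t => [i|c|k F ts IH] //=; exact: term_definable_app.
elim: phi m kappa tau => {n} [n|n t u|n k r ts|n p IHp q IHq|n p IH] m kappa tau dk dt /=.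
- exact: formula_definable_False.
- by apply: formula_definable_eq; exact: evalP.
- by apply: formula_definable_rel => i; exact: evalP.
- by apply: formula_definable_imp; [exact: IHp|exact: IHq].
apply: formula_definable_all.
(* Under the quantifier, the substituted terms ignore the new last variable, which is substituted
   for itself. *)
apply: (IH _ (fun c w => kappa c (fun i => w (lift ord_max i)))
  (fun j w => extend (fun i => tau i (fun i => w (lift ord_max i))) (w ord_max) j)).
  by move=> c; exact: term_definable_reindex.
move=> j; rewrite /extend; case: unliftP => [i _|_] /=.
  exact: (term_definable_reindex _ (dt i)).
exact: term_definable_var.
Qed.

End Definability.

(** * Parameter sets and definable sets and binary relations *)

Section ParameterSets.
Context (L : language) (M : Type) (S : structure L M).
Implicit Types (A B : set M) (n : nat).

Lemma term_definable_sub A B n (f : ('I_n -> M) -> M) :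
  A `<=` B -> term_definable S A f -> term_definable S B f.
Proof.
move=> AB [t tE]; suff [u uE] : term_definable S B
    (fun v => eval S (fun a : A => set_val a) v t) by exists u => v; rewrite uE.
elim: t {f tE} => [i|a|k F ts IH] /=.
- exact: term_definable_var.
- by apply: term_definable_cst; apply/AB/set_valP.
- exact: term_definable_app.
Qed.

Lemma formula_definable_sub A B n (P : ('I_n -> M) -> Prop) :
  A `<=` B -> formula_definable S A P -> formula_definable S B P.
Proof.
move=> AB [phi phiE]; apply: formula_definable_ext phiE _.
apply: (formula_definable_subst phi (kappa := fun a _ => set_val a)
  (tau := fun i v => v i)) => [a|i]; last exact: term_definable_var.
by apply: term_definable_cst; apply/AB/set_valP.
Qed.

(** Serves the arguments of a symbol: its arity is finite, so the union of their parameter sets is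
    still finite, and by monotonicity it works for all of them. *)
Lemma choose_finite_parameters A k (D : 'I_k -> set M -> Prop) :
  (forall i Y Z, Y `<=` Z -> D i Y -> D i Z) ->
  (forall i, exists Y, [/\ finite_set Y, Y `<=` A & D i Y]) ->
  exists Y, [/\ finite_set Y, Y `<=` A & forall i, D i Y].
Proof.
move=> Dmono /choice[Y YP]; exists (\bigcup_i Y i); split.
- by apply: bigcup_finite => [|i _]; [exact: finite_finset|have [] := YP i].
- by move=> x [i _]; have [_ + _] := YP i; apply.
- by move=> i; have [_ _] := YP i; apply: Dmono => x Yx; exists i.
Qed.

Lemma term_finite_parameters A n (t : term L A n) :
  exists Y, [/\ finite_set Y, Y `<=` A &
    term_definable S Y (fun v => eval S (fun a : A => set_val a) v t)].
Proof.
elim: t => [i|a|k F ts IH] /=.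
- by exists set0; split => //; exact: term_definable_var.
- exists [set set_val a]; split => //; first by move=> _ ->; exact: set_valP.
  exact: term_definable_cst.
have [i Y Z YZ|Y [fY YA dY]] := choose_finite_parameters _ IH.
  exact: term_definable_sub.
by exists Y; split => //; exact: term_definable_app.
Qed.

(** Only finitely many constants occur in a formula; this gives [discl] its finite character. *)
Lemma formula_finite_parameters A n (phi : formula L A n) :
  exists Y, [/\ finite_set Y, Y `<=` A &
    formula_definable S Y (sat S (fun a : A => set_val a) phi)].
Proof.
elim: phi => {n} [n|n t u|n k r ts|n p [Y [fY YA dp]] q [Z [fZ ZA dq]]|
  n p [Y [fY YA dp]]] /=.
- by exists set0; split => //; exact: formula_definable_False.
- have [Y [fY YA dt]] := term_finite_parameters t.
  have [Z [fZ ZA du]] := term_finite_parameters u.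
  exists (Y `|` Z); split; [by rewrite finite_setU|by rewrite subUset|].
  apply: formula_definable_eq.
    by apply: term_definable_sub dt; exact: subsetUl.
  by apply: term_definable_sub du; exact: subsetUr.
- have [i Y Z YZ|Y [fY YA dY]] :=
    choose_finite_parameters _ (fun i => term_finite_parameters (ts i)).
    exact: term_definable_sub.
  by exists Y; split => //; exact: formula_definable_rel.
- exists (Y `|` Z); split; [by rewrite finite_setU|by rewrite subUset|].
  apply: formula_definable_imp.
    by apply: formula_definable_sub dp; exact: subsetUl.
  by apply: formula_definable_sub dq; exact: subsetUr.
- exists Y; split => //.
  have [phi phiE] := dp; exists (All phi) => v /=.
  by split => H y; apply/phiE.
Qed.

(** Quantifying over all definable terms [f] builds closure under substitution into the notion;
    [set_definableP] recovers the usual one. *)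
Definition set_definable A (X : set M) : Prop :=
  forall n (f : ('I_n -> M) -> M), term_definable S A f ->
    formula_definable S A (fun v => X (f v)).

Definition rel_definable A (R : M -> M -> Prop) : Prop :=
  forall n (f g : ('I_n -> M) -> M),
    term_definable S A f -> term_definable S A g ->
    formula_definable S A (fun v => R (f v) (g v)).

Lemma set_definableP A (X : set M) :
  set_definable A X <->
  formula_definable S A (fun v : 'I_1 -> M => X (v ord0)).
Proof.
split=> [dX|[phi phiE] n f df]; first exact/dX/term_definable_var.
have := formula_definable_subst phi (S := S) (A := A) (kappa := fun a _ => set_val a)
  (tau := fun _ => f) _ (fun=> df).
move=> /(_ (fun a => term_definable_cst S n (set_valP a))).
by apply: formula_definable_ext => v; rewrite phiE.
Qed.

Lemma rel_definableP A (R : M -> M -> Prop) :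
  rel_definable A R <->
  formula_definable S A (fun v : 'I_2 -> M => R (v ord0) (v ord_max)).
Proof.
split=> [dR|[phi phiE] n f g df dg]; first by apply: dR; exact: term_definable_var.
have := formula_definable_subst phi (S := S) (A := A) (kappa := fun a _ => set_val a)
  (tau := fun i => if i == ord0 then f else g).
move=> /(_ (fun a => term_definable_cst S n (set_valP a))) H.
have /H : forall i : 'I_2, term_definable S A (if i == ord0 then f else g).
  by move=> i; case: ifP.
by apply: formula_definable_ext => v; rewrite phiE.
Qed.

Lemma set_definable_sub A B X : A `<=` B ->
  set_definable A X -> set_definable B X.
Proof. by move=> AB /set_definableP dX; apply/set_definableP/(formula_definable_sub AB). Qed.

Lemma rel_definable_sub A B R : A `<=` B ->
  rel_definable A R -> rel_definable B R.
Proof. by move=> AB /rel_definableP dR; apply/rel_definableP/(formula_definable_sub AB). Qed.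

Lemma set_definable_finite_parameters A X : set_definable A X ->
  exists Y, [/\ finite_set Y, Y `<=` A & set_definable Y X].
Proof.
move=> /set_definableP[phi phiE].
have [Y [fY YA dY]] := formula_finite_parameters phi.
by exists Y; split => //; apply/set_definableP/(formula_definable_ext phiE).
Qed.

Lemma rel_definable_fiber A R b : rel_definable A R ->
  set_definable (A `|` [set b]) (R b).
Proof.
move=> dR n f df; apply: (rel_definable_sub (@subsetUl _ A [set b]) dR) => //.
by apply: term_definable_cst; right.
Qed.

Lemma rel_definable_section R x : rel_definable setT R ->
  set_definable setT (R x).
Proof. by move=> dR; have := rel_definable_fiber (b := x) dR; rewrite setTU. Qed.

Lemma set_definable_uncurry A X b : set_definable (A `|` [set b]) X ->
  exists2 R, rel_definable A R & forall x, X x <-> R x b.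
Proof.
move=> /set_definableP[phi phiE].
(* Constants from [A] are kept; any other constant is [b] and becomes the variable [y]. *)
pose kappa (c : (A `|` [set b])%classic) y :=
  if pselect (A (set_val c)) then set_val c else y.
exists (fun x y => sat S (kappa^~ y) phi (fun=> x)).
  move=> n f g df dg; apply: (formula_definable_subst phi
    (kappa := fun c v => kappa c (g v)) (tau := fun _ => f)) => // c.
  by rewrite /kappa; case: pselect => // Ac; exact: term_definable_cst.
move=> x; rewrite -(phiE (fun=> x)); suff -> : kappa^~ b = (fun c => set_val c) by [].
apply/funext => c; rewrite /kappa; case: pselect => // nAc.
by have [//|cb] := set_valP c; exact/esym.
Qed.

End ParameterSets.

(** * Definable subsets of the line *)

Section OrderLemmas.
Context (d : Order.disp_t) (T : orderType d).
Implicit Types (N U : set T).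

Lemma common_lower_bound (J : eqType) (r : seq J) (z : J -> T) N n : N n ->
  (forall i, N (z i)) ->
  exists w, [/\ N w, w <= n & forall i, i \in r -> w <= z i].
Proof.
move=> Nn Nz; elim: r => [|i r [w [Nw wn wz]]]; first by exists n; split.
have [wi|iw] := leP w (z i).
  by exists w; split => // j; rewrite inE => /orP[/eqP ->|/wz].
exists (z i); split=> [//||j]; first exact: le_trans (ltW iw) wn.
by rewrite inE => /orP[/eqP -> //|/wz]; exact/le_trans/ltW.
Qed.

(* Only finitely many convex pieces are available, so one of them is coinitial
   in [N], and convexity makes it an initial segment. *)
Lemma initial_segment_in_union (J : finType) (C : J -> set T) N U n :
  (forall i x y z, C i x -> C i y -> x <= z -> z <= y -> C i z) ->
  N n -> (forall z, N z -> z <= n -> (U z <-> exists i, C i z)) ->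
  (forall z, N z -> exists u, [/\ N u, U u & u <= z]) ->
  exists2 w, N w & forall z, N z -> z <= w -> U z.
Proof.
move=> Cconv Nn UC Ucoinit.
have [[i Ci]|/forallNP nC] := pselect (exists i, forall z, N z ->
    exists u, [/\ N u, C i u & u <= z]).
  have [w [Nw Cw wn]] := Ci _ Nn; exists w => // z Nz zw.
  have [u [Nu Cu uz]] := Ci _ Nz.
  by apply/(UC _ Nz (le_trans zw wn)); exists i; exact: Cconv Cu Cw uz zw.
(* If no piece is coinitial, each one misses an initial part of [N]; below a common bound of these
   parts [U] has no point, against its coinitiality. *)
have /choice[z zP] : forall i, exists z, N z /\
    forall u, N u -> C i u -> ~ u <= z.
  move=> i; have /existsNP[z /not_implyP[Nz nz]] := nC i.
  by exists z; split => // u Nu Cu uz; apply: nz; exists u.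
have [|w [Nw wn wz]] := common_lower_bound (enum J) Nn (z := z).
  by move=> i; have [] := zP i.
have [u [Nu Uu uw]] := Ucoinit _ Nw.
have [i Ciu] := (UC _ Nu (le_trans uw wn)).1 Uu.
have [_ /(_ _ Nu Ciu)] := zP i; case.
by apply/(le_trans uw)/wz; rewrite mem_enum.
Qed.

End OrderLemmas.

(** * Intervals and the order topology *)

Section DefinableTopology.
Context (L : language) (lt_sym : rel_sym L 2) (d : Order.disp_t).
Context (M : orderTopologicalType d) (S : structure L M).
Hypothesis lt_symE : forall v : 'I_2 -> M,
  rel_interp S lt_sym v <-> v ord0 < v ord_max.
Hypothesis dloM : dense_without_endpoints M.
Implicit Types (A X N U : set M) (x y z s t : M).

Lemma formula_definable_lt A n (f g : ('I_n -> M) -> M) :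
  term_definable S A f -> term_definable S A g ->
  formula_definable S A (fun v => f v < g v).
Proof.
move=> df dg; have := @formula_definable_rel L M S A n 2 lt_sym
  (fun i => if i == ord0 then f else g).
case=> [i|phi phiE]; first by case: ifP.
by exists phi => v; rewrite phiE lt_symE.
Qed.

Lemma formula_definable_le A n (f g : ('I_n -> M) -> M) :
  term_definable S A f -> term_definable S A g ->
  formula_definable S A (fun v => f v <= g v).
Proof.
move=> df dg; have := formula_definable_not (formula_definable_lt dg df).
by apply: formula_definable_ext => v; rewrite leNgt; split => /negP.
Qed.

(** This is largeness. It is written with endpoints in [M], hence first order, so it can be imposed
    on the fibers of a definable family. *)
Definition has_interval X : Prop :=
  exists s t, s < t /\ forall u, s < u -> u < t -> X u.

Lemma has_interval_sub X U : X `<=` U -> has_interval X -> has_interval U.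
Proof. by move=> XU [s [t [st H]]]; exists s, t; split => // u su /(H _ su)/XU. Qed.

Ltac definability := repeat first
  [ assumption
  | apply: term_definable_var
  | apply: formula_definable_lt
  | apply: formula_definable_le
  | apply: formula_definable_eq
  | apply: formula_definable_and
  | apply: formula_definable_or
  | apply: formula_definable_not
  | apply: formula_definable_ex
  | apply: formula_definable_all
  | apply: formula_definable_imp
  | by apply: term_definable_cst
  | by apply: term_definable_reindex
  | match goal with H : set_definable _ _ _ |- _ => apply: H end
  | match goal with H : rel_definable _ _ _ |- _ => apply: H end ].

Lemma formula_definable_has_interval A n (P : ('I_n -> M) -> M -> Prop) :
  formula_definable S A
    (fun w : 'I_n.+1 -> M => P (fun i => w (lift ord_max i)) (w ord_max)) ->
  formula_definable S A (fun v => has_interval [set y | P v y]).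
Proof.
move=> [phi phiE]; rewrite /has_interval /=; do 2 apply: formula_definable_ex.
apply: formula_definable_and; first by definability.
apply: formula_definable_all; definability.
(* Three variables have been appended, the two endpoints and the point between them. The old
   variables are lifted three times, and the last variable of [phi] becomes the point between. *)
pose e (j : 'I_n.+1) : 'I_n.+3 := oapp (fun i => lift ord_max (lift ord_max (lift ord_max i)))
  ord_max (unlift ord_max j).
have := formula_definable_subst phi (S := S) (A := A)
  (kappa := fun a _ => set_val a) (tau := fun j v => v (e j)).
move=> /(_ (fun a => term_definable_cst S _ (set_valP a))
  (fun j => term_definable_var S A (e j))).
apply: formula_definable_ext => v; rewrite phiE /e unlift_none /=.
by under eq_fun do rewrite liftK.
Qed.

Lemma set_definable_not_has_interval A R : rel_definable S A R ->
  set_definable S A [set y | ~ has_interval [set x | R x y]].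
Proof.
move=> dR n f df /=; apply: formula_definable_not.
by apply: formula_definable_has_interval; definability.
Qed.

Lemma between x y : x < y -> exists z, x < z /\ z < y.
Proof. by case: dloM => _ + _ _ => /[apply] -[z /andP[]]; exists z. Qed.

Lemma below x : exists y, y < x.
Proof. by case: dloM. Qed.

Lemma above x : exists y, x < y.
Proof. by case: dloM. Qed.

Lemma open_ends_sub (I : interval M) x : itv_open_ends I -> x \in I ->
  exists s t, [/\ s < x, x < t & forall u, s < u -> u < t -> u \in I].
Proof.
case: I => [[[] l|[]] [[] r|[]]] // _; rewrite in_itv /= ?andbT.
- by move=> /andP[lx xr]; exists l, r; split => // u lu ur; rewrite in_itv /= lu ur.
- move=> lx; have [t xt] := above x; exists l, t; split => // u lu _.
  by rewrite in_itv /= lu.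
- move=> xr; have [s sx] := below x; exists s, r; split => // u _ ur; rewrite in_itv.
- have [[s sx] [t xt]] := (below x, above x).
  by exists s, t; split => // u _ _; rewrite in_itv.
Qed.

Lemma nbhs_segment x U : nbhs x U <->
  exists s t, [/\ s < x, x < t & forall u, s < u -> u < t -> U u].
Proof.
rewrite itv_nbhsE; split=> [[I [oI xI] IU]|[s [t [sx xt stU]]]].
  have [s [t [sx xt stI]]] := open_ends_sub oI xI.
  by exists s, t; split => // u su ut; exact/IU/stI.
exists `]s, t[%O; first by rewrite in_itv /= sx.
by move=> u /=; rewrite in_itv /= => /andP[]; exact: stU.
Qed.

Lemma nbhs_has_interval x U : nbhs x U -> has_interval U.
Proof.
by move=> /nbhs_segment[s [t [sx xt stU]]]; exists s, t; split => //; exact: lt_trans xt.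
Qed.

Lemma discrete_not_has_interval X : discrete_subset X -> ~ has_interval X.
Proof.
move=> dX [s [t [st stX]]]; have [x [sx xt]] := between st.
have [_ [V /nbhs_segment[s' [t' [s'x xt' V']]] VX]] := dX _ (stX _ sx xt).
have /between[z [xz]] : x < Order.min t t' by rewrite lt_min xt.
rewrite lt_min => /andP[zt zt'].
have zx : [set x] z.
  by rewrite -VX; split; [apply: V' (lt_trans _ xz) _|apply: stX (lt_trans _ xz) _].
by rewrite zx ltxx in xz.
Qed.

(** * Small definable sets are discrete and closed *)

Hypothesis starM : star_locally_weakly_o_minimal S.

Lemma definable_unary X : set_definable S setT X -> definable S (unary X).
Proof.
move=> /set_definableP[phi phiE]; exists phi; apply/funext => v.
by apply/propext; apply: iff_sym; exact: phiE.
Qed.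

Lemma Pt_in_map_itv x (I : interval M) : Pt S x \in map_itv (Pt S) I -> x \in I.
Proof.
have PtE a b : (Pt S a < Pt S b) = (a < b) by rewrite !ltNge.
by case: I => [[[] l|[]] [[] r|[]]]; rewrite !in_itv /= ?PtE.
Qed.

(** Near [x] the set is finite up to open convex pieces; a nonempty piece would contain an interval,
    so only the finite part remains. *)
Lemma locally_finite X x : set_definable S setT X -> ~ has_interval X ->
  exists F V, [/\ finite_set F, nbhs x V & X `&` V `<=` F].
Proof.
move=> dX nX; have [I [oI xI [F [n [U [fF oU XI]]]]]] :=
  starM (definable_unary dX) (Pt S x).
have {}XI : X `&` [set` I] = F `|` \bigcup_i U i := XI.
exists F, [set` I]; split => //.
  by rewrite itv_nbhsE; exists I => //; split => //; exact: Pt_in_map_itv xI.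
move=> y [Xy Iy]; have [//|[i _ Uiy]] : (F `|` \bigcup_i U i) y by rewrite -XI.
case: nX.
have UX : U i `<=` X.
  by move=> z Uz; have [] : (X `&` [set` I]) z by rewrite XI; right; exists i.
apply: has_interval_sub UX (nbhs_has_interval (x := y) _).
by apply: open_nbhs_nbhs; split => //; have [] := oU i.
Qed.

(** The point [x] is not assumed to lie in [X], so this yields both discreteness and closedness. The
    other points of the local finite set form a closed set, which is removed from the
    neighbourhood. *)
Lemma not_has_interval_isolated X x : set_definable S setT X -> ~ has_interval X ->
  exists2 V, nbhs x V & V `&` X `<=` [set x].
Proof.
move=> dX nX; have [F [V [fF Vx XF]]] := locally_finite x dX nX.
have cF : closed (F `\ x).
  apply: (accessible_finite_set_closed.1 (hausdorff_accessible order_hausdorff)).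
  exact: finite_setD.
exists (V `&` ~` (F `\ x)).
  apply: filterI => //; apply: open_nbhs_nbhs; split; first exact: closed_openC.
  by case=> _ /(_ erefl).
move=> y [[Vy nFy] Xy]; apply: contrapT => nyx; apply: nFy; split => //.
by apply: XF.
Qed.

Lemma not_has_interval_discrete X : set_definable S setT X -> ~ has_interval X ->
  discrete_subset X.
Proof.
move=> dX nX x Xx; split; first exact/mem_set.
have [V Vx VX] := not_has_interval_isolated x dX nX; exists V => //.
by apply/seteqP; split => // _ ->; split => //; exact: nbhs_singleton.
Qed.

Lemma not_has_interval_closed X : set_definable S setT X -> ~ has_interval X ->
  closed X.
Proof.
move=> dX nX x clX; apply: contrapT => nXx.
have [V Vx VX] := not_has_interval_isolated x dX nX.
by have [y [Xy Vy]] := clX _ Vx; apply: nXx; rewrite -(VX y).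
Qed.

(** Trades the topological condition for smallness, which is first order. *)
Lemma disclP A a : discl S A a <->
  exists X, [/\ set_definable S A X, X a & ~ has_interval X].
Proof.
split=> [[phi /= [phia dX _]]|[X [dX Xa nX]]].
  exists [set t | solutions S phi (fun=> t)]; split => //.
    apply/set_definableP; exists phi => v; rewrite /solutions /=.
    suff -> : v = fun=> v ord0 by [].
    by apply/funext => i; rewrite ord1.
  exact: discrete_not_has_interval.
have [phi phiE] := (set_definableP S A X).1 dX; exists phi => /=.
have -> : [set t | solutions S phi (fun=> t)] = X.
  by apply/funext => t; apply/propext/phiE.
have dX' := set_definable_sub (@subsetT _ A) dX; split.
- exact/phiE.
- exact: not_has_interval_discrete.
- exact: not_has_interval_closed.
Qed.

Lemma segment_sub s t s' t' : s' < t' ->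
  (forall u, s' < u -> u < t' -> s < u /\ u < t) -> s <= s' /\ t' <= t.
Proof.
move=> st' sub; split; rewrite leNgt; apply/negP.
  move=> s's; have /between[z []] : s' < Order.min s t' by rewrite lt_min s's.
  rewrite lt_min => s'z /andP[zs zt']; have [sz _] := sub _ s'z zt'.
  by have := lt_trans zs sz; rewrite ltxx.
move=> tt'; have /between[z []] : Order.max s' t < t' by rewrite gt_max st'.
rewrite gt_max => /andP[s'z tz] zt'; have [_ zt] := sub _ s'z zt'.
by have := lt_trans zt tz; rewrite ltxx.
Qed.

Lemma split_interval X s t : set_definable S setT X -> s < t ->
  exists s' t', [/\ s <= s', s' < t', t' <= t &
    (forall u, s' < u -> u < t' -> X u) \/ (forall u, s' < u -> u < t' -> ~ X u)].
Proof.
move=> dX st; pose Y := [set u | [/\ s < u, u < t & X u]].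
have [[s' [t' [st' Y']]]|nY] := pselect (has_interval Y).
  have [|ss' tt'] := @segment_sub s t s' t' st'.
    by move=> u su /(Y' _ su)[].
  by exists s', t'; split => //; left => u su ut; have [] := Y' _ su ut.
have dY : set_definable S setT Y.
  move=> n f df; apply: (@formula_definable_ext _ _ _ _ _
    (fun v => s < f v /\ f v < t /\ X (f v))) => [v|].
    by split=> [[? []]|[]].
  by definability.
have [x [sx xt]] := between st.
have [V /nbhs_segment[s0 [t0 [s0x xt0 V0]]] VY] := not_has_interval_isolated x dY nY.
(* With [x] as left endpoint, the only point of [X] possible near [x], namely [x] itself, is left
   out. *)
exists x, (Order.min t t0); split; rewrite ?ge_min ?lexx ?lt_min ?xt ?(ltW sx) //.
right => u xu; rewrite lt_min => /andP[ut ut0] Xu.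
have ux : u = x.
  by apply: VY; split; [exact/V0/ut0/lt_trans/xu|split => //; exact: lt_trans xu].
by rewrite ux ltxx in xu.
Qed.

(** * Suprema of definable cuts in the completion *)

Lemma Pt_lt x y : (Pt S x < Pt S y) = (x < y).
Proof. by rewrite !ltNge. Qed.

Lemma Pt_le_Gap x (g : definable_gap S) : (Pt S x <= Gap g) = `[< gap_lower g x >].
Proof. by []. Qed.

Lemma Gap_le_Pt x (g : definable_gap S) : (Gap g <= Pt S x) = `[< gap_upper g x >].
Proof. by []. Qed.

Lemma between_completion (m : completion S) x :
  m < Pt S x -> exists y, m < Pt S y /\ y < x.
Proof.
case: m => [a|g].
  by rewrite Pt_lt => /between[z [az zx]]; exists z; rewrite Pt_lt.
rewrite ltNge Pt_le_Gap => /asboolP /gap_lowerNupper gx.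
have [y gy yx] : exists2 y, gap_upper g y & y < x.
  by case: g gx => A B /= [_ _ _ _]; apply.
by exists y; split => //; rewrite ltNge Pt_le_Gap; apply/asboolP/gap_lowerNupper.
Qed.

Definition initial Q := forall x y, x <= y -> Q y -> Q x.

(** Three cases: [Q] has a maximum, or its complement has a minimum, or the two form a definable
    gap. In each case that point or gap is the supremum. *)
Lemma initial_sup (Q : set M) q n : set_definable S setT Q -> initial Q ->
  Q q -> ~ Q n -> exists m, supremums (Pt S @` Q) m.
Proof.
move=> dQ Qdown Qq nQn.
have ltQ x y : Q x -> ~ Q y -> x < y.
  by move=> Qx nQy; rewrite ltNge; apply/negP => /Qdown /(_ Qx).
have [[a [Qa aQ]]|nmax] := pselect (exists a, Q a /\ ubound Q a).
  exists (Pt S a); split=> [_ [y Qy <-]|u]; first exact: aQ.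
  by apply; exists a.
have [[b [nQb Qb]]|nmin] := pselect (exists b, ~ Q b /\ forall y, y < b -> Q y).
  exists (Pt S b); split=> [_ [y Qy <-]|u uQ]; first by rewrite ltW // Pt_lt ltQ.
  rewrite leNgt; apply/negP => /between_completion[y [uy yb]].
  by have := lt_le_trans uy (uQ _ (imageP _ (Qb _ yb))); rewrite ltxx.
have gapQ : is_definable_gap S Q (~` Q).
  split.
  - split; [exact: definable_unary| |by exists q|by exists n].
    apply: definable_unary => k f df /=.
    by apply: formula_definable_not; exact: dQ.
  - exact: setUv.
  - exact: ltQ.
  - move=> a Qa; apply: contrapT => na; apply: nmax; exists a; split => // y Qy.
    by rewrite leNgt; apply/negP => ay; apply: na; exists y.
  - move=> b nQb; apply: contrapT => nb; apply: nmin; exists b; split => // y yb.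
    by apply: contrapT => nQy; apply: nb; exists y.
exists (Gap (DefinableGap gapQ)); split=> [_ [y Qy <-]|u uQ].
  by rewrite Pt_le_Gap; apply/asboolP.
rewrite leNgt; apply/negP; case: u uQ => [b|h] uQ.
  rewrite ltNge Gap_le_Pt => /asboolP /= /contrapT Qb.
  apply: nmax; exists b; split => // y Qy; exact: uQ (imageP _ Qy).
rewrite ltNge => /negP; apply; apply/asboolP => y /= Qy.
by have := uQ _ (imageP _ Qy); rewrite Pt_le_Gap => /asboolP.
Qed.

Lemma lt_sup (Q : set M) m x : supremums (Pt S @` Q) m -> Pt S x < m ->
  exists y, Q y /\ x < y.
Proof.
move=> [_ mQ] xm; apply: contrapT => /forallNP nQ.
have : m <= Pt S x.
  apply: mQ => _ [y Qy <-]; rewrite leNgt Pt_lt; apply/negP => xy.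
  exact: (nQ y).
by rewrite leNgt xm.
Qed.

Lemma sup_lt (Q : set M) m x : supremums (Pt S @` Q) m -> m < Pt S x ->
  exists y, ~ Q y /\ y < x.
Proof.
move=> [Qm _] /between_completion[y [my yx]]; exists y; split => // Qy.
by have := lt_le_trans my (Qm _ (imageP _ Qy)); rewrite ltxx.
Qed.

(** Local weak o-minimality is applied at the supremum of [Q], possibly a gap; the interval obtained
    reaches to both sides of the cut. *)
Lemma finitely_many_pieces X (Q : set M) q0 n0 :
  set_definable S setT X -> set_definable S setT Q -> initial Q ->
  Q q0 -> ~ Q n0 ->
  exists q n (J : finType) (C : J -> set M), [/\ Q q, ~ Q n,
    (forall i x y z, C i x -> C i y -> x <= z -> z <= y -> C i z) &
    forall z, q <= z -> z <= n -> (X z <-> exists i, C i z)].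
Proof.
move=> dX dQ Qdown Qq0 nQn0; have [m mQ] := initial_sup dQ Qdown Qq0 nQn0.
have [I [oI mI [F [k [U [/finite_seqP[s Fs] oU XI]]]]]] := starM (definable_unary dX) m.
have {}XI : X `&` [set` I] = F `|` \bigcup_i U i := XI.
(* On a side where [I] is unbounded, the given [q0] or [n0] serves. *)
have [q [n [Qq nQn qnI]]] : exists q n,
    [/\ Q q, ~ Q n & forall z, q <= z -> z <= n -> z \in I].
  have lowerQ := lt_sup mQ; have upperQ := sup_lt mQ.
  case: I oI mI {XI} => [[[] l|[]] [[] r|[]]] // _; rewrite in_itv /= ?andbT.
  - move=> /andP[/lowerQ[q [Qq lq]] /upperQ[n [nQn nr]]]; exists q, n; split => // z qz zn.
    by rewrite in_itv /= (lt_le_trans lq) // (le_lt_trans zn).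
  - move=> /lowerQ[q [Qq lq]]; exists q, n0; split => // z qz _.
    by rewrite in_itv /= (lt_le_trans lq).
  - move=> /upperQ[n [nQn nr]]; exists q0, n; split => // z _ zn.
    by rewrite in_itv /= (le_lt_trans zn).
  - by exists q0, n0; split => // z _ _; rewrite in_itv.
(* The pieces are the singletons of the finite part together with the convex sets; in [nth], [q] is
   only a default value. *)
exists q, n, ('I_(size s) + 'I_k)%type.
exists (fun i : 'I_(size s) + 'I_k => match i with inl i => [set nth q s i] | inr i => U i end).
split=> // [[i|i] x y z|z qz zn].
- by move=> -> -> xz zx; apply/le_anti; rewrite xz zx.
- move=> Ux Uy; rewrite le_eqVlt => /predU1P[<-//|xz].
  rewrite le_eqVlt => /predU1P[->//|zy]; have [_ Uconv] := oU i.
  by apply: Uconv Ux Uy _; rewrite xz.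
have Iz := qnI _ qz zn; split=> [Xz|H].
  have : (F `|` \bigcup_i U i) z by rewrite -XI.
  rewrite Fs => -[/= zs|[i _ Uz]]; last by exists (inr i).
  have zs' := zs; rewrite -index_mem in zs'.
  by exists (inl (Ordinal zs')); rewrite /= nth_index.
suff [] : (X `&` [set` I]) z by [].
rewrite XI; have [[i ->|i Ui]] := H; last by right; exists i.
by left; rewrite Fs /=; exact: mem_nth.
Qed.

(** * Definable families of cuts *)

Hypothesis contM : univariate_star_continuity S.

(* Continuity at x of the function sending each z to the supremum of the initial
   segment [R z], also meaningful when that segment is empty or everything. *)
Definition cut_continuous (R : M -> M -> Prop) x : Prop :=
  (forall y y', y < y' -> R x y' -> \forall z \near x, R z y) /\
  (forall y y', y' < y -> ~ R x y' -> \forall z \near x, ~ R z y).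

Lemma near_segment s t x U : s < x -> x < t ->
  (forall u, s < u -> u < t -> U u) -> \forall z \near x, U z.
Proof. by move=> sx xt stU; apply/nbhs_segment; exists s, t. Qed.

(** The supremum of [R x] is a definable function of [x], hence continuous on a subinterval. The
    supremum does not tell whether it is itself attained, which is why [cut_continuous] leaves slack
    between [y] and [y']. *)
Lemma cut_continuity_proper R s t : rel_definable S setT R ->
  (forall x, initial (R x)) -> s < t ->
  (forall x, s < x -> x < t -> exists y y', R x y /\ ~ R x y') ->
  exists s' t', [/\ s <= s', s' < t', t' <= t &
    forall x, s' < x -> x < t' -> cut_continuous R x].
Proof.
move=> dR Rdown st Rproper.
pose I := `]s, t[%O : interval M.
have inI x : x \in I = (s < x) && (x < t) by rewrite in_itv.
(* The default [Pt S x] is taken only where no supremum exists, which does not happen between [s]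
   and [t]. *)
pose f x := xget (Pt S x) (supremums (Pt S @` R x)).
have fP x : s < x -> x < t -> supremums (Pt S @` R x) (f x).
  move=> sx xt; have [y [y' [Ry nRy']]] := Rproper _ sx xt.
  by apply: xgetPex; exact: initial_sup (rel_definable_section x dR) (Rdown x) Ry nRy'.
have extend0 (v : 'I_1 -> M) y : extend v y ord0 = v ord0.
  by rewrite /extend (_ : ord0 = lift ord_max ord0) ?liftK //; exact: val_inj.
have extend1 (v : 'I_1 -> M) y : extend v y ord_max = y.
  by rewrite /extend unlift_none.
have fdef : definable_fun (unary [set` I]) (fun v => f (v ord0)).
  exists [set w | [/\ s < w ord0, w ord0 < t & R (w ord0) (w ord_max)]]; split.
  - have [phi phiE] : formula_definable S setT (fun w : 'I_2 -> M =>
        s < w ord0 /\ w ord0 < t /\ R (w ord0) (w ord_max)).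
      by definability.
    exists phi; apply/funext => w; apply/propext; apply: iff_sym.
    by rewrite /solutions /= phiE; split=> [[? []]|[]].
  - apply/seteqP; split=> v; rewrite /unary /= inI.
      by move=> [y]; rewrite extend0 => -[-> ->].
    move=> /andP[sv vt]; have [y [_ [Ry _]]] := Rproper _ sv vt.
    by exists y; rewrite extend0 extend1.
  move=> v; rewrite /unary /= inI => /andP[sv vt].
  suff -> : [set y | [/\ s < extend v y ord0, extend v y ord0 < t &
      R (extend v y ord0) (extend v y ord_max)]] = R (v ord0) by exact: fP.
  by apply/seteqP; split=> y /=; rewrite extend0 extend1; [case|].
have I0 : [set` I] !=set0.
  by have [x [sx xt]] := between st; exists x; rewrite /= inI sx.
have [J [oJ [x1 Jx1] JI fJ]] := contM (isT : itv_open_ends I) I0 fdef.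
have [s' [t' [s'x1 x1t' stJ]]] := open_ends_sub oJ Jx1.
have s't' := lt_trans s'x1 x1t'.
have stI u : s' < u -> u < t' -> s < u /\ u < t.
  by move=> su ut; have := JI _ (stJ _ su ut); rewrite /= inI => /andP.
have [ss' tt'] := segment_sub s't' stI.
exists s', t'; split => // x s'x xt'.
have [sx xt] := stI _ s'x xt'.
have fx : {for x, continuous f}.
  move: fJ; rewrite continuous_open_subspace; last exact: itv_open_ends_open.
  by move=> /(_ x (mem_set (stJ _ s'x xt'))).
have fPnear : \forall z \near x, supremums (Pt S @` R z) (f z).
  apply: (near_segment s'x xt') => z s'z zt'.
  by have [sz zt] := stI _ s'z zt'; exact: fP.
split=> y y' yy' Rxy'.
  (* The slack makes the inequality strict, so it persists near [x] because rays are open. *)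
  have yf : Pt S y < f x.
    rewrite (@lt_le_trans _ _ (Pt S y')) ?Pt_lt //.
    by have [ub _] := fP _ sx xt; exact: ub (imageP _ Rxy').
  have /fx yfnear : nbhs (f x) `]Pt S y, +oo[%classic.
    by apply: open_nbhs_nbhs; split; [exact: rray_open|rewrite /= in_itv /= yf].
  near=> z; have yfz : Pt S y < f z.
    have : `]Pt S y, +oo[%classic (f z) by near: z.
    by rewrite /= in_itv /= andbT.
  have fz : supremums (Pt S @` R z) (f z) by near: z.
  by have [u [Ru yu]] := lt_sup fz yfz; apply: Rdown Ru; exact: ltW.
have fy : f x < Pt S y.
  rewrite (@le_lt_trans _ _ (Pt S y')) ?Pt_lt //.
  have [_ lub] := fP _ sx xt; apply: lub => _ [u Ru <-].
  by rewrite leNgt Pt_lt; apply/negP => /ltW y'u; exact/Rxy'/(Rdown _ _ _ y'u).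
have /fx fynear : nbhs (f x) `]-oo, Pt S y[%classic.
  by apply: open_nbhs_nbhs; split; [exact: lray_open|rewrite /= in_itv /= fy].
near=> z; have fzy : f z < Pt S y.
  have : `]-oo, Pt S y[%classic (f z) by near: z.
  by rewrite /= in_itv.
have [fz _] : supremums (Pt S @` R z) (f z) by near: z.
by move=> Rzy; have := lt_le_trans fzy (fz _ (imageP _ Rzy)); rewrite ltxx.
Unshelve. all: by end_near. Qed.

(** After shrinking the interval, the segments are all empty, all equal to [M], or all proper. The
    first two cases are constant families. *)
Lemma cut_continuity R s t : rel_definable S setT R ->
  (forall x, initial (R x)) -> s < t ->
  exists s' t', [/\ s <= s', s' < t', t' <= t &
    forall x, s' < x -> x < t' -> cut_continuous R x].
Proof.
move=> dR Rdown st.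
have dE : set_definable S setT [set x | forall y, ~ R x y].
  by move=> n f df /=; definability.
have [s1 [t1 [ss1 st1 tt1 [E1|nE1]]]] := split_interval dE st.
  exists s1, t1; split => // x sx xt; split=> y y' yy' Rxy'; first by have := E1 _ sx xt y'.
  by apply: (near_segment sx xt) => z sz zt; exact: E1.
have dT : set_definable S setT [set x | forall y, R x y].
  by move=> n f df /=; definability.
have [s2 [t2 [ss2 st2 tt2 [T2|nT2]]]] := split_interval dT st1.
  exists s2, t2; split; [exact: le_trans ss2|by []|exact: le_trans tt1|].
  move=> x sx xt; split=> y y' yy' Rxy'; last by have := T2 _ sx xt y'.
  by apply: (near_segment sx xt) => z sz zt; exact: T2.
have [x s2x xt2|s3 [t3 [ss3 st3 tt3 R3]]] := cut_continuity_proper dR Rdown st2.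
  have /existsNP[y /contrapT Ry] := nE1 _ (le_lt_trans ss2 s2x) (lt_le_trans xt2 tt2).
  by have /existsNP[y' nRy'] := nT2 _ s2x xt2; exists y, y'.
exists s3, t3; split => //; first exact/(le_trans ss1)/(le_trans ss2).
exact/(le_trans tt3)/(le_trans tt2).
Qed.

(** At a point of continuity of both cuts, [y2] is strictly inside the gap between them, with [y1]
    and [y3] as slack, so it stays inside for all nearby [x]. *)
Lemma has_interval_between_cuts P Q s t :
  rel_definable S setT P -> rel_definable S setT Q ->
  (forall x, initial (P x)) -> (forall x, initial (Q x)) -> s < t ->
  (forall x, s < x -> x < t ->
    exists y1 y2 y3, [/\ y1 < y2, y2 < y3, ~ Q x y1 & P x y3]) ->
  exists y, has_interval [set x | P x y /\ ~ Q x y].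
Proof.
move=> dP dQ Pdown Qdown st PQ.
have [s1 [t1 [ss1 st1 tt1 P1]]] := cut_continuity dP Pdown st.
have [s2 [t2 [ss2 st2 tt2 Q2]]] := cut_continuity dQ Qdown st1.
have [x [s2x xt2]] := between st2.
have [s1x xt1] := (le_lt_trans ss2 s2x, lt_le_trans xt2 tt2).
have [y1 [y2 [y3 [y12 y23 nQ1 P3]]]] := PQ _ (le_lt_trans ss1 s1x) (lt_le_trans xt1 tt1).
exists y2; apply: (nbhs_has_interval (x := x)).
have [Pcont _] := P1 _ s1x xt1; have [_ Qcont] := Q2 _ s2x xt2.
by apply: filterI; [exact: Pcont P3|exact: Qcont nQ1].
Qed.

(** * Interiors of the fibers of a definable relation *)

Definition interior_rel (R : M -> M -> Prop) x y : Prop :=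
  exists p q, p < y /\ y < q /\ forall z, p < z -> z < q -> R x z.

Lemma interior_rel_definable R : rel_definable S setT R ->
  rel_definable S setT (interior_rel R).
Proof. by move=> dR n f g df dg; rewrite /interior_rel; definability. Qed.

Lemma interior_rel_sub R x y : interior_rel R x y -> R x y.
Proof. by move=> [p [q [py [yq]]]]; apply. Qed.

Lemma interior_rel_left R x y p : interior_rel R x y -> p < y ->
  exists z, [/\ p < z, z < y & interior_rel R x z].
Proof.
move=> [p' [q [p'y [yq pq]]]] py.
have /between[z []] : Order.max p p' < y by rewrite gt_max py.
rewrite gt_max => /andP[pz p'z] zy; exists z; split => //.
by exists p', q; split => //; split => //; exact: lt_trans yq.
Qed.

Lemma interior_rel_right R x y : interior_rel R x y ->
  exists z, y < z /\ interior_rel R x z.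
Proof.
move=> [p [q [py [/between[z [yz zq]] pq]]]]; exists z; split => //.
by exists p, q; split => //; exact: lt_trans yz.
Qed.

Lemma has_interval_interior_rel R x : has_interval (R x) ->
  exists y, interior_rel R x y.
Proof.
by move=> [s [t [/between[y [sy yt]] stR]]]; exists y, s, t.
Qed.

Section OneSided.
Variables (R : M -> M -> Prop) (s t : M).
Hypotheses (dR : rel_definable S setT R) (st : s < t).
Let U := interior_rel R.
Let dU : rel_definable S setT U := interior_rel_definable dR.

(** [Q x] is the cut just below the part of [U x] above [c], and [P x] is the cut at the end of its
    first convex component. Between the two cuts lies that component. *)
Lemma has_interval_above c :
  (forall x, s < x -> x < t -> exists2 y, c < y & U x y) ->
  exists y, has_interval [set x | R x y].
Proof.
move=> Uc.
pose Q x y := forall u, U x u -> c < u -> y < u.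
pose P x y := forall z, z <= y -> U x z \/ Q x z.
have dQ : rel_definable S setT Q.
  by move=> n f g df dg; rewrite /Q; definability.
have dP : rel_definable S setT P.
  by move=> n f g df dg; rewrite /P; definability.
have Qdown x : initial (Q x).
  by move=> y y' yy' Qy' u Uu cu; exact/(le_lt_trans yy')/Qy'.
have Pdown x : initial (P x).
  by move=> y y' yy' Py' z zy; exact/Py'/(le_trans zy).
have Qc x : Q x c by [].
have NU x z : ~ Q x z -> exists u, [/\ ~ Q x u, U x u, c < u & u <= z].
  move=> /existsNP[u /not_implyP[Uu /not_implyP[cu /negP]]].
  rewrite -leNgt => uz; exists u; split => // /(_ _ Uu cu).
  by rewrite ltxx.
have Nleft x z : ~ Q x z -> exists z', z' < z /\ ~ Q x z'.
  move=> /NU[u [nQu Uu cu uz]]; have [v [cv vu Uv]] := interior_rel_left Uu cu.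
  by exists v; split => [|/(_ _ Uv cv)]; [exact: lt_le_trans uz|rewrite ltxx].
have [x sx xt|y iPQ] := has_interval_between_cuts dP dQ Pdown Qdown st.
  have [u0 cu0 Uu0] := Uc _ sx xt.
  have nQu0 : ~ Q x u0 by move=> /(_ _ Uu0 cu0); rewrite ltxx.
  (* Finiteness of the pieces at the cut [Q x] ensures that a first component exists. *)
  have [q [n [J [C [Qq nQn Cconv UC]]]]] := finitely_many_pieces
    (rel_definable_section x dU) (rel_definable_section x dQ) (Qdown x) (Qc x) nQu0.
  have [z nQz zn|z /NU[u [nQu Uu _ uz]]|w nQw Uw] :=
    @initial_segment_in_union _ _ J C (~` Q x) (U x) n Cconv nQn.
  - apply: UC zn; rewrite leNgt; apply/negP => zq; apply: nQz.
    exact: Qdown (ltW zq) Qq.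
  - by exists u.
  (* Since [U x] is open, the complement of [Q x] has no least element; this provides room for the
     slack. *)
  have [y2 [y2w nQy2]] := Nleft _ _ nQw.
  have [y1 [y12 nQy1]] := Nleft _ _ nQy2.
  exists y1, y2, w; split => // z zw.
  by have [Qz|nQz] := pselect (Q x z); [right|left; exact: Uw].
exists y; apply: has_interval_sub iPQ => x [/(_ y (lexx y))[Uy|//] _].
exact: interior_rel_sub.
Qed.

(** Mirror image: [P x] ends where [U x] ends, and [Q x] ends where the last component of [U x]
    begins. The bound [c] makes [P x] a proper cut. *)
Lemma has_interval_below c :
  (forall x, s < x -> x < t -> exists y, U x y) ->
  (forall x, s < x -> x < t -> forall y, U x y -> y <= c) ->
  exists y, has_interval [set x | R x y].
Proof.
move=> U0 Uc.
pose P x y := exists u, U x u /\ y <= u.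
pose Q x y := exists z, y <= z /\ P x z /\ ~ U x z.
have dP : rel_definable S setT P.
  by move=> n f g df dg; rewrite /P; definability.
have dQ : rel_definable S setT Q.
  by move=> n f g df dg; rewrite /Q; definability.
have Pdown x : initial (P x).
  by move=> y y' yy' [u [Uu y'u]]; exists u; split => //; exact: le_trans y'u.
have Qdown x : initial (Q x).
  by move=> y y' yy' [z [y'z Pz]]; exists z; split => //; exact: le_trans y'z.
have Pright x z : P x z -> exists z', z < z' /\ P x z'.
  move=> [u [/interior_rel_right[v [uv Uv]] zu]]; exists v; split.
    exact: le_lt_trans uv.
  by exists v.
have [x sx xt|y iPQ] := has_interval_between_cuts dP dQ Pdown Qdown st.
  have [u0 Uu0] := U0 _ sx xt.
  have Pu0 : P x u0 by exists u0.
  have [c' cc'] := above c.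
  have nPc' : ~ P x c'.
    move=> [u [Uu c'u]]; have := le_trans c'u (Uc _ sx xt _ Uu).
    by rewrite leNgt cc'.
  have [q [n [J [C [Pq nPn Cconv UC]]]]] := finitely_many_pieces
    (rel_definable_section x dU) (rel_definable_section x dP) (Pdown x) Pu0 nPc'.
  (* In the dual order [M^d], an initial segment is a final segment of [P x]. *)
  have [i y z v Ciy Ciz yv vz|z Pz qz|z [u [Uu zu]]|w Pw Uw] :=
    @initial_segment_in_union _ M^d J C (P x) (U x) q _ Pq.
  - exact: Cconv Ciz Ciy vz yv.
  - apply: UC qz _; rewrite leNgt; apply/negP => nz; apply: nPn.
    exact: Pdown (ltW nz) Pz.
  - by exists u; split => //; exists u.
  have [y2 [wy2 Py2]] := Pright _ _ Pw.
  have [y3 [y23 Py3]] := Pright _ _ Py2.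
  by exists w, y2, y3; split => // -[z [wz [Pz]]]; apply; exact: Uw.
exists y; apply: has_interval_sub iPQ => x [Px nQ].
by apply: interior_rel_sub; apply: contrapT => nU; apply: nQ; exists y.
Qed.

End OneSided.

(** The interior of a fiber may be unbounded with no first or last component, so an arbitrary [c] is
    fixed. On a subinterval, either all interiors reach above [c] or none does, and a one-sided
    lemma applies. *)
Lemma not_has_interval_fibers R : rel_definable S setT R ->
  (forall y, ~ has_interval [set x | R x y]) ->
  ~ has_interval [set x | has_interval (R x)].
Proof.
move=> dR nR [s [t [st stR]]].
have [[c _] _ _ _] := dloM.
have dU := interior_rel_definable dR.
have dV : set_definable S setT [set x | exists y, c < y /\ interior_rel R x y].
  by move=> n f df /=; definability.
have [s' [t' [ss' st' tt' V]]] := split_interval dV st.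
have U0 x : s' < x -> x < t' -> exists y, interior_rel R x y.
  move=> sx xt; apply: has_interval_interior_rel; apply: stR.
    exact: le_lt_trans sx.
  exact: lt_le_trans tt'.
have [y] : exists y, has_interval [set x | R x y]; last exact: nR.
case: V => V.
  apply: (has_interval_above dR st' (c := c)) => x sx xt.
  by have [y [cy Uy]] := V _ sx xt; exists y.
apply: (has_interval_below dR st' (c := c)) => // x sx xt y Uy.
by rewrite leNgt; apply/negP => cy; apply: (V _ sx xt); exists y.
Qed.

(** * The closure operator *)

Lemma discl_sub A B : A `<=` B -> discl S A `<=` discl S B.
Proof.
move=> AB a /disclP[X [dX Xa nX]]; apply/disclP; exists X; split => //.
exact: set_definable_sub dX.
Qed.

Lemma subset_discl A : A `<=` discl S A.
Proof.
move=> a Aa; apply/disclP; exists [set a]; split => //.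
  move=> n f df /=; apply: formula_definable_eq => //.
  exact: term_definable_cst.
move=> [s [t [/between[x [sx xt]] sta]]].
have [y [xy yt]] := between xt.
have xa : x = a by exact: sta.
have ya : y = a by apply: sta yt; exact: lt_trans xy.
by rewrite xa ya ltxx in xy.
Qed.

Lemma discl_finite A a : discl S A a ->
  exists Y, [/\ finite_set Y, Y `<=` A & discl S Y a].
Proof.
move=> /disclP[X [dX Xa nX]].
have [Y [fY YA dY]] := set_definable_finite_parameters dX.
by exists Y; split => //; apply/disclP; exists X.
Qed.

(** Only the fiber at [b] is known to be small. Discarding every large fiber is definable over [A]
    and does not affect the fiber at [b]. *)
Lemma discl_fiber A a b : discl S (A `|` [set b]) a ->
  exists R, [/\ rel_definable S A R, R a b & forall y, ~ has_interval [set x | R x y]].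
Proof.
move=> /disclP[X [dX Xa nX]].
have [R0 dR0 XR0] := set_definable_uncurry dX.
pose R x y := R0 x y /\ ~ has_interval [set x' | R0 x' y].
have dR : rel_definable S A R.
  move=> n f g df dg; apply: formula_definable_and; first exact: dR0.
  exact: set_definable_not_has_interval.
exists R; split => // [|y iR].
  split; first exact/XR0.
  by apply: contra_not nX; apply: has_interval_sub => x /XR0.
have [s [t [/between[x [sx xt]] stR]]] := iR.
have [_] := stR _ sx xt; apply.
by apply: has_interval_sub iR => z [].
Qed.

Lemma discl_exchange A a b :
  discl S (A `|` [set b]) a -> ~ discl S A a -> discl S (A `|` [set a]) b.
Proof.
move=> /discl_fiber[R [dR Rab nR]] na.
have dRT := rel_definable_sub (@subsetT _ A) dR.
apply/disclP; exists (R a); split => //; first exact: rel_definable_fiber.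
move=> iRa; apply: na; apply/disclP.
exists [set x | has_interval (R x)]; split => //.
  by move=> n f df; apply: formula_definable_has_interval; definability.
exact: not_has_interval_fibers.
Qed.

(* [U x y] asserts that the successor d of y in the discrete set D satisfies
   [R x d]; the fibers of U are thus those of R over D, indexed by intervals
   instead of points. *)
Lemma discl_discl1 A b : discl S A b -> discl S (A `|` [set b]) `<=` discl S A.
Proof.
move=> /disclP[D [dD Db nD]] a /discl_fiber[R [dR Rab nR]].
pose U x y := exists e, D e /\ y < e /\ (forall z, y < z -> z < e -> ~ D z) /\ R x e.
have dU : rel_definable S A U.
  by move=> n f g df dg; rewrite /U; definability.
(* The successor of [y] in [D] is unique, so the fiber of [U] over [y] lies inside one fiber of
   [R]. *)
have nU y : ~ has_interval [set x | U x y].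
  move=> iU; have [s [t [/between[x [sx xt]] stU]]] := iU.
  have [e [De [ye [eD _]]]] := stU _ sx xt.
  apply: (nR e); apply: has_interval_sub iU => z [e' [De' [ye' [eD' Rze']]]] /=.
  have [ee'|e'e|-> //] := ltgtP e e'; first by case: (eD' _ ye ee').
  by case: (eD _ ye' e'e).
apply/disclP; exists [set x | has_interval (U x)]; split.
- by move=> n f df; apply: formula_definable_has_interval; definability.
- have dDT := set_definable_sub (@subsetT _ A) dD.
  (* As [b] is isolated in [D], it is the successor of every [y] in some interval ending at [b];
     hence [U a] is large. *)
  have [V /nbhs_segment[s [t [sb bt stV]]] VD] := not_has_interval_isolated b dDT nD.
  exists s, b; split => // y sy yb; exists b; split => //; split => //; split => // z yz zb Dz.
  have zb' : z = b.
    by apply: VD; split => //; apply: stV; [exact: lt_trans yz|exact: lt_trans bt].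
  by rewrite zb' ltxx in zb.
- exact: not_has_interval_fibers (rel_definable_sub (@subsetT _ A) dU) nU.
Qed.

Lemma discl_discl A : discl S (discl S A) = discl S A.
Proof.
apply/seteqP; split; last exact: subset_discl.
(* Finite character leaves finitely many parameters from [discl S A], which are eliminated one at a
   time. *)
move=> a /discl_finite[_ [/finite_seqP[r ->] rA ra]].
have {ra} : discl S (A `|` [set` r]) a by apply: discl_sub ra; exact: subsetUr.
elim: r rA => [_|b r IH brA]; first by rewrite set_nil setU0.
have -> : A `|` [set` b :: r] = A `|` [set` r] `|` [set b].
  rewrite -setUA; congr (_ `|` _); apply/seteqP; split=> x /=; rewrite inE.
    by move=> /orP[/eqP ->|]; [right|left].
  by move=> [->|->]; rewrite ?eqxx ?orbT.
move=> ra.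
apply: IH => [x xr|]; first by apply: brA; rewrite /= inE xr orbT.
apply: discl_discl1 ra; apply: discl_sub (brA b _); first exact: subsetUl.
by rewrite /= inE eqxx.
Qed.

End DefinableTopology.

Theorem theorem4p29 (L : language) (lt_sym : rel_sym L 2)
    (d : Order.disp_t) (M : orderTopologicalType d) (S : structure L M)
    (lt_symE : forall v : 'I_2 -> M,
       rel_interp S lt_sym v <-> (v ord0 < v ord_max)%O)
    (dloM : dense_without_endpoints M)
    (starM : star_locally_weakly_o_minimal S)
    (contM : univariate_star_continuity S) :
  pregeometry (discl S).
Proof.
move=> A; split.
- exact: subset_discl.
- exact: discl_discl.
- by move=> a b [] /discl_exchange H /H; exact.
- by move=> a; exact: discl_finite.
Qed.
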